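(* Let $D\subseteq\mathbf{R}^2$. There is a bijective correspondence between: (1) finite r-measures $\mu$ on $D$, where ''finite'' means $\mu(R)<\infty$ for every $R\in\mathrm{Rect}(D)$; and (2) locally finite multisets $A$ in the r-interior $D^{\bullet}$ of $D$, where ''locally finite'' means $\mathrm{card}(A|_R)<\infty$ for every $R\in\mathrm{Rect}(D)$. The measure $\mu$ corresponding to a multiset $A$ is related to it by the formula $$\mu(R)=\mathrm{card}(A|_R)\qquad\text{for every }R\in\mathrm{Rect}(D).$$
   Context: For $D\subseteq\mathbf{R}^2$, $\mathrm{Rect}(D)$ is the set of closed rectangles $[a,b]\times[c,d]\subseteq D$ with $a<b$ and $c<d$ real. An r-measure on $D$ is a function $\mu:\mathrm{Rect}(D)\to\{0,1,2,\dots\}\cup\{\infty\}$ which is additive under splitting: whenever $[a,b]\times[c,d]\in\mathrm{Rect}(D)$, $a<p<b$ and $c<q<d$, $\mu([a,b]\times[c,d])=\mu([a,p]\times[c,d])+\mu([p,b]\times[c,d])$ and $\mu([a,b]\times[c,d])=\mu([a,b]\times[c,q])+\mu([a,b]\times[q,d])$. A decorated real number is a symbol $p^+$ or $p^-$ with $p\in\mathbf{R}$; $p^*$ stands for either. Decorated and ordinary reals are ordered by $p^-<p<p^+$, and $p^+<q^-$ whenever $p<q$. A decorated point is a pair $(p^*,q^* )$ of decorated reals. It belongs to $R=[a,b]\times[c,d]$, written $(p^*,q^* )\in R$, if $a<p^*<b$ and $c<q^*<d$ (i.e. the point $(p,q)$ together with a short tick pointing into the quadrant indicated by the decorations lies in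 $R$). The r-interior of $D$ is $D^{\bullet}=\{(p^*,q^* )\mid \text{there is }R\in\mathrm{Rect}(D)\text{ with }(p^*,q^* )\in R\}$. A multiset in a set $S$ is given by a multiplicity function $\mathrm{m}:S\to\{0,1,2,\dots\}\cup\{\infty\}$. For a multiset $A$ in $D^{\bullet}$, $A|_R$ is its restriction to the decorated points belonging to $R$, and $\mathrm{card}(A|_R)=\sum_{(p^*,q^* )\in R}\mathrm{m}(p^*,q^* )$. *)

(* Defs.v *)
From HB Require Import structures.
From mathcomp Require Import all_boot all_order all_algebra.
From mathcomp Require Import all_classical all_reals all_analysis.

Set Implicit Arguments.
Unset Strict Implicit.
Unset Printing Implicit Defensive.

Import Order.TTheory GRing.Theory Num.Theory.

Local Open Scope classical_set_scope.
Local Open Scope ring_scope.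

(** {0, 1, 2, ...} with infinity, encoded as [None]. *)
Definition enat := option nat.

Definition add_enat (m n : enat) : enat :=
  if (m, n) is (Some i, Some j) then Some (i + j)%N else None.

Definition ereal_of_enat (R : realType) (n : enat) : \bar R :=
  if n is Some i then (i%:R)%:E else +oo%E.

(** Nonempty interior is part of the data, so the corners are determined by the
    underlying subset of the plane. *)
Record rect (R : realType) (D : set (R * R)) := Rect {
  xmin : R;
  xmax : R;
  ymin : R;
  ymax : R;
  rect_x : xmin < xmax;
  rect_y : ymin < ymax;
  rect_sub : `[xmin, xmax] `*` `[ymin, ymax] `<=` D
}.

Section Splitting.
Context (R : realType) (D : set (R * R)) (r : rect D).

Lemma subset_rect (a b c d : R) :
    xmin r <= a -> b <= xmax r -> ymin r <= c -> d <= ymax r ->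
  `[a, b] `*` `[c, d] `<=` D.
Proof.
move=> ha hb hc hd; apply: subset_trans (@rect_sub _ _ r).
by move=> x [h1 h2]; split; [move: h1 | move: h2];
  apply: subset_itv; rewrite bnd_simp.
Qed.

Section Vertical.
Context (p : R) (hp : xmin r < p < xmax r).

Definition left_part : rect D :=
  Rect (proj1 (andP hp)) (rect_y r)
    (subset_rect (lexx _) (ltW (proj2 (andP hp))) (lexx _) (lexx _)).

Definition right_part : rect D :=
  Rect (proj2 (andP hp)) (rect_y r)
    (subset_rect (ltW (proj1 (andP hp))) (lexx _) (lexx _) (lexx _)).
End Vertical.

Section Horizontal.
Context (q : R) (hq : ymin r < q < ymax r).

Definition lower_part : rect D :=
  Rect (rect_x r) (proj1 (andP hq))
    (subset_rect (lexx _) (lexx _) (lexx _) (ltW (proj2 (andP hq)))).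

Definition upper_part : rect D :=
  Rect (rect_x r) (proj2 (andP hq))
    (subset_rect (lexx _) (lexx _) (ltW (proj1 (andP hq))) (lexx _)).
End Horizontal.
End Splitting.

Definition is_rmeasure (R : realType) (D : set (R * R)) (mu : rect D -> enat) :=
  (forall (r : rect D) (p : R) (hp : xmin r < p < xmax r),
     mu r = add_enat (mu (left_part hp)) (mu (right_part hp))) /\
  (forall (r : rect D) (q : R) (hq : ymin r < q < ymax r),
     mu r = add_enat (mu (lower_part hq)) (mu (upper_part hq))).

Definition finite_rmeasures (R : realType) (D : set (R * R)) :
    set (rect D -> enat) :=
  [set mu | is_rmeasure mu /\ forall r : rect D, mu r <> None].
Arguments finite_rmeasures {R} D _.

(** [(p, true)] is p^+ and [(p, false)] is p^-. *)
Definition dreal (R : realType) : Type := (R * bool)%type.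

HB.instance Definition _ (R : realType) := Choice.on (dreal R).

(** a < p^* and p^* < b, for the order generated by p^- < p < p^+ and
    p^+ < q^- whenever p < q. *)
Definition lt_real_dreal (R : realType) (a : R) (p : dreal R) : bool :=
  (a < p.1) || ((a == p.1) && p.2).

Definition lt_dreal_real (R : realType) (p : dreal R) (b : R) : bool :=
  (p.1 < b) || ((p.1 == b) && ~~ p.2).

Definition dpoint (R : realType) : Type := (dreal R * dreal R)%type.

HB.instance Definition _ (R : realType) := Choice.on (dpoint R).

Definition in_rect (R : realType) (D : set (R * R)) (x : dpoint R)
    (r : rect D) : bool :=
  [&& lt_real_dreal (xmin r) x.1, lt_dreal_real x.1 (xmax r),
      lt_real_dreal (ymin r) x.2 & lt_dreal_real x.2 (ymax r)].

Definition rinterior (R : realType) (D : set (R * R)) : set (dpoint R) :=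
  [set x | exists r : rect D, in_rect x r].

(** [S -> enat] is the type of multisets in [S]; the set [rinterior D] is
    coerced to the subtype of its elements. *)
Definition card_restr (R : realType) (D : set (R * R))
    (A : rinterior D -> enat) (r : rect D) : \bar R :=
  (\esum_(x in [set x : rinterior D | in_rect (val x) r])
     ereal_of_enat R (A x))%E.

Definition locally_finite_multisets (R : realType) (D : set (R * R)) :
    set (rinterior D -> enat) :=
  [set A | forall r : rect D, (card_restr A r < +oo)%E].
Arguments locally_finite_multisets {R} D _.

(* Main.v *)
(** The multiplicity of a decorated point is the least measure of a rectangle
    containing it. Around a decorated point [z], a rectangle of least measure
    isolates [z]: any other decorated point is separated from [z] by a line
    parallel to an axis, and the part on the side away from [z] is null. So
    measure and cardinality agree on small rectangles around each decorated
    point, and Cousin's lemma for decorated points extends this to every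
    rectangle because both are additive under splitting. Conversely, the
    cardinality on an isolating rectangle recovers the multiplicity of [z],
    whence uniqueness. *)

Require Import Defs.
From HB Require Import structures.
From mathcomp Require Import all_boot all_order all_algebra.
From mathcomp Require Import all_classical all_reals all_analysis.
From mathcomp Require Import zify.

Set Implicit Arguments.
Unset Strict Implicit.
Unset Printing Implicit Defensive.

Import Order.TTheory GRing.Theory Num.Theory.

Local Open Scope classical_set_scope.
Local Open Scope ring_scope.

(** * Extended natural numbers and their sums *)

Section ExtendedNaturals.
Context (R : realType).

Lemma ereal_of_enat_ge0 (n : enat) : (0 <= ereal_of_enat R n)%E.
Proof. by case: n => [n|] /=; rewrite ?lee_fin ?ler0n ?leey. Qed.

(** Equalities in [enat] can thus be checked in the extended reals, where cardinalities are sums. *)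
Lemma ereal_of_enat_inj : injective (ereal_of_enat R).
Proof. by move=> [m|] [n|] //= [/eqP]; rewrite eqr_nat => /eqP ->. Qed.

Lemma ereal_of_enatD (m n : enat) :
  (ereal_of_enat R (add_enat m n) = ereal_of_enat R m + ereal_of_enat R n)%E.
Proof. by case: m n => [m|] [n|] //=; rewrite natrD EFinD. Qed.

Lemma fsum_ereal_of_enat (T : choiceType) (f : T -> enat) (X : set T) :
  finite_set X ->
  exists n, ereal_of_enat R n = (\sum_(x \in X) ereal_of_enat R (f x))%E.
Proof.
move=> finX; rewrite fsbig_finite//=.
elim/big_ind: _ => [|_ _ [m <-] [n <-]|x _]; first by exists (Some 0%N).
- by exists (add_enat m n); rewrite ereal_of_enatD.
- by exists (f x).
Qed.

(** The finite partial sums form a set of extended naturals, so their supremum,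
    when finite, is attained. *)
Lemma esum_ereal_of_enat (T : choiceType) (f : T -> enat) (S : set T) :
  exists n, ereal_of_enat R n = (\esum_(x in S) ereal_of_enat R (f x))%E.
Proof.
have [s_oo|s_fin] :=
  eqVneq (\esum_(x in S) ereal_of_enat R (f x))%E (+oo%E : \bar R).
  by exists None.
have s_ge0 : (0 <= \esum_(x in S) ereal_of_enat R (f x))%E.
  by apply: esum_ge0 => x _; exact: ereal_of_enat_ge0.
case s_eq: (\esum_(x in S) _)%E s_ge0 s_fin => [s| |]// _ _.
pose P n := `[< exists2 X, fsets S X &
  ereal_of_enat R (Some n) = (\sum_(x \in X) ereal_of_enat R (f x))%E >].
have P_le n : P n -> n%:R <= s.
  move=> /asboolP[X SX nX]; rewrite -lee_fin -s_eq; apply: esum_ge.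
  by exists X; rewrite -?nX.
have exP : exists n, P n.
  exists 0%N; apply/asboolP; exists set0; first exact: fsets_set0.
  by rewrite fsbig_set0.
(* The integer part of [s] bounds all finite partial sums, so a largest one exists. *)
have ubP n : P n -> (n <= Num.truncn s)%N.
  by move=> /P_le ns; rewrite truncn_ge_nat ?(le_trans _ ns).
case: (ex_maxnP exP ubP) => n Pn n_max; exists (Some n); rewrite -s_eq.
apply/eqP; rewrite eq_le; apply/andP; split.
  by rewrite s_eq lee_fin; exact: P_le.
apply: ge_ereal_sup => _ [X SX <-].
have [k kX] := fsum_ereal_of_enat f SX.1; rewrite -kX.
have k_le : (ereal_of_enat R k <= s%:E)%E.
  by rewrite -s_eq; apply: esum_ge; exists X => //; rewrite kX.
case: k k_le kX => [k|]/= k_le kX; last by rewrite leye_eq in k_le.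
by rewrite lee_fin ler_nat; apply: n_max; apply/asboolP; exists X.
Qed.

End ExtendedNaturals.

(** * Decorated reals: order, separation, Cousin's lemma *)

Section DecoratedReals.
Context (R : realType).
Implicit Types (a b : R) (y z : dreal R).

(** A decorated real never equals a real, so exactly one of the two comparisons holds. Facts about
    upper bounds then follow from those about lower bounds. *)
Lemma lt_dreal_realN z b : lt_dreal_real z b = ~~ lt_real_dreal b z.
Proof.
by rewrite /lt_dreal_real /lt_real_dreal; case: z => p [] /=; case: ltgtP.
Qed.

Lemma lt_real_dreal_trans a b z :
  a <= b -> lt_real_dreal b z -> lt_real_dreal a z.
Proof.
rewrite /lt_real_dreal => ab /orP[/(le_lt_trans ab)->//|/andP[/eqP <- ->]].
by rewrite andbT orbC -le_eqVlt.
Qed.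

Lemma lt_dreal_real_trans a b z :
  a <= b -> lt_dreal_real z a -> lt_dreal_real z b.
Proof.
by move=> ab; rewrite !lt_dreal_realN; apply/contra/lt_real_dreal_trans.
Qed.

Lemma lt_real_dreal_real a b z :
  lt_real_dreal a z -> lt_dreal_real z b -> a < b.
Proof.
by rewrite lt_dreal_realN ltNge => az; apply: contra => /lt_real_dreal_trans->.
Qed.

(** A midpoint separates distinct base points; over a common base point, that real itself lies
    between its two decorations. *)
Lemma dreal_separated y z : y != z ->
  exists p, (lt_dreal_real y p && lt_real_dreal p z) ||
            (lt_dreal_real z p && lt_real_dreal p y).
Proof.
rewrite /lt_dreal_real /lt_real_dreal; case: y z => [y b] [z c] /=.
have [yz _|zy _|<- bc] := ltgtP y z.
- by exists ((y + z) / 2); rewrite midf_lt//= midf_lt.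
- by exists ((z + y) / 2); rewrite !(midf_lt zy) orbT.
- by exists y; case: b c bc => [] []; rewrite /= ?eqxx ?ltxx.
Qed.

(** Cousin's lemma, with a one-sided neighbourhood for each decoration. *)
Lemma dreal_cousin (P : R -> R -> Prop) a b : a < b ->
    (forall s p t, s < p -> p < t -> P s p -> P p t -> P s t) ->
    (forall z, lt_real_dreal a z -> lt_dreal_real z b ->
       exists s t, [/\ lt_real_dreal s z, lt_dreal_real z t &
         forall s' t', s <= s' -> t' <= t ->
           lt_real_dreal s' z -> lt_dreal_real z t' -> P s' t']) ->
  P a b.
Proof.
move=> ab Padd Ploc.
have right_loc p : a <= p -> p < b ->
    exists2 e, p < e <= b & forall t, p < t <= e -> P p t.
  move=> ap pb; have [||s [t [sz zt Pst]]] := Ploc (p, true).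
  - by rewrite /lt_real_dreal/= andbT orbC -le_eqVlt.
  - by rewrite /lt_dreal_real/= pb.
  - have sp : s <= p by move: sz; rewrite /lt_real_dreal/= andbT orbC -le_eqVlt.
    have pt : p < t by move: zt; rewrite /lt_dreal_real/= andbF orbF.
    exists (Num.min t b); first by rewrite lt_min pt pb ge_min lexx orbT.
    move=> u /andP[pu]; rewrite le_min => /andP[ut ub]; apply: Pst => //.
      by rewrite /lt_real_dreal/= eqxx orbT.
    by rewrite /lt_dreal_real/= pu.
have left_loc p : a < p -> p <= b ->
    exists2 e, e < p & forall s, e <= s < p -> P s p.
  move=> ap pb; have [||s [t [sz zt Pst]]] := Ploc (p, false).
  - by rewrite /lt_real_dreal/= ap.
  - by rewrite /lt_dreal_real/= andbT orbC -le_eqVlt.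
  - have pt : p <= t by move: zt; rewrite /lt_dreal_real/= andbT orbC -le_eqVlt.
    have sp : s < p by move: sz; rewrite /lt_real_dreal/= andbF orbF.
    exists s => // u /andP[su up]; apply: Pst => //.
      by rewrite /lt_real_dreal/= up.
    by rewrite /lt_dreal_real/= eqxx orbT.
(* [S] collects the endpoints that can be reached from [a]; its supremum is shown to be reached and
   to equal [b]. *)
pose S : set R := [set t | a < t <= b /\ P a t].
have [e ae Pae] := right_loc a (lexx a) ab.
have Se : S e by split => //; apply: Pae; rewrite lexx andbT; case/andP: ae.
have S_ub : ubound S b by move=> t [/andP[]].
have S_sup : has_sup S by split; [exists e | exists b].
set u := sup S.
have au : a < u.
  by apply: lt_le_trans (sup_upper_bound S_sup Se); case/andP: ae.
have ub : u <= b by apply: ge_sup; [exists e|].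
(* Some [t] in [S] lies in the left neighbourhood of [u]; unless [t] is [u], gluing at [t] gives
   [P a u]. *)
have Pau : P a u.
  have [e' e'u Pe'u] := left_loc u au ub.
  have [|t [/andP[at_ tb] Pat]] := @sup_adherent _ S (u - e') _ S_sup.
    by rewrite subr_gt0.
  rewrite subKr => e't.
  have := sup_upper_bound S_sup (conj (introT andP (conj at_ tb)) Pat).
  rewrite le_eqVlt => /orP[/eqP tu|tu]; first by rewrite /u -tu.
  by apply: (Padd a t u) => //; apply: Pe'u; rewrite (ltW e't).
(* If [u < b], the right neighbourhood of [u] would put a larger point into [S]. *)
move: ub; rewrite le_eqVlt => /orP[/eqP <-//|ub].
have [e' /andP[ue' e'b] Pue'] := right_loc u (ltW au) ub.
have Se' : S e'.
  split; first by rewrite (lt_trans au ue').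
  by apply: (Padd a u e') => //; apply: Pue'; rewrite ue' lexx.
by have := sup_upper_bound S_sup Se'; rewrite leNgt ue'.
Qed.

End DecoratedReals.

(** * Rectangles, the decorated points in them, and cardinalities *)

Section Rectangles.
Context (R : realType) (D : set (R * R)).
Implicit Types r s : rect D.

Lemma rect_eq r s : xmin r = xmin s -> xmax r = xmax s ->
  ymin r = ymin s -> ymax r = ymax s -> r = s.
Proof.
case: r s => [a b c d ab cd rD] [a' b' c' d' ab' cd' sD] /= aE bE cE dE.
move: aE bE cE dE ab' cd' sD => <- <- <- <- ab' cd' sD.
by congr Rect; exact: Prop_irrelevance.
Qed.

Definition rect_le s r :=
  [&& xmin r <= xmin s, xmax s <= xmax r, ymin r <= ymin s & ymax s <= ymax r].

(** The one-dimensional lemma is applied to the horizontal side and, within its local step, to the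
    vertical side, as in the tube lemma. *)
Lemma rect_cousin (P : rect D -> Prop) :
    (forall r p (hp : xmin r < p < xmax r),
       P (left_part hp) -> P (right_part hp) -> P r) ->
    (forall r q (hq : ymin r < q < ymax r),
       P (lower_part hq) -> P (upper_part hq) -> P r) ->
    (forall z r, in_rect z r -> exists2 s, in_rect z s &
       forall s', rect_le s' s -> in_rect z s' -> P s') ->
  forall r, P r.
Proof.
move=> Px Py Ploc r.
(* The vertical side stays that of [r]. Quantifying over [r'] avoids building a rectangle from its
   sides. *)
pose Q x0 x1 := forall r', xmin r' = x0 -> xmax r' = x1 ->
  ymin r' = ymin r -> ymax r' = ymax r -> P r'.
suff: Q (xmin r) (xmax r) by exact.
apply: dreal_cousin (rect_x r) _ _ => [a p b ap pb Qap Qpb r' ra rb rc rd|z1].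
  have hp : xmin r' < p < xmax r' by rewrite ra rb ap.
  by apply: (Px _ _ hp); [exact: Qap | exact: Qpb].
move=> rz1 z1r.
(* With [z1] fixed, [Q'] asks for one horizontal neighbourhood of [z1] that serves the whole
   vertical side from [y0] to [y1]. *)
pose Q' (y0 y1 : R) := exists s t : R,
  [/\ lt_real_dreal s z1, lt_dreal_real z1 t &
    forall r', s <= xmin r' -> xmax r' <= t ->
      lt_real_dreal (xmin r') z1 -> lt_dreal_real z1 (xmax r') ->
      ymin r' = y0 -> ymax r' = y1 -> P r'].
suff [s [t [sz1 z1t Pst]]] : Q' (ymin r) (ymax r).
  exists s, t; split=> // s' t' ? ? ? ? r' ? ? ? ?.
  by subst; apply: Pst.
apply: dreal_cousin (rect_y r) _ _.
  move=> c q d cq qd [s [t [sz zt Pc]]] [s' [t' [s'z zt' Pd]]].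
  (* The intersection of the two neighbourhoods of [z1] serves both the lower and the upper part. *)
  exists (Num.max s s'), (Num.min t t'); split.
  - by rewrite maxEle; case: ifP.
  - by rewrite minEle; case: ifP.
  move=> r'; rewrite ge_max le_min => /andP[sr s'r] /andP[rt rt'] rz zr rc rd.
  have hq : ymin r' < q < ymax r' by rewrite rc rd cq.
  by apply: (Py _ _ hq); [apply: Pc | apply: Pd].
move=> z2 rz2 z2r.
have [|s /and4P[sz1 z1s sz2 z2s] Ps] := Ploc (z1, z2) r.
  by rewrite /in_rect rz1 z1r rz2 z2r.
exists (ymin s), (ymax s); split=> // c d sc ds cz zd.
exists (xmin s), (xmax s); split=> // r' ss rs rz zr rc rd.
by apply: Ps; rewrite /rect_le /in_rect ?rc ?rd ?ss ?rs ?sc ?ds ?rz ?zr ?cz ?zd.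
Qed.

Lemma in_left_part (z : dpoint R) r p (hp : xmin r < p < xmax r) :
  in_rect z (left_part hp) = in_rect z r && ~~ lt_real_dreal p z.1.
Proof.
rewrite /in_rect /= -lt_dreal_realN; case/andP: hp => _ /ltW pr.
have := @lt_dreal_real_trans _ _ _ z.1 pr.
by case: (lt_dreal_real z.1 p) => [->//|_]; rewrite ?andbF ?andbT.
Qed.

Lemma in_right_part (z : dpoint R) r p (hp : xmin r < p < xmax r) :
  in_rect z (right_part hp) = in_rect z r && lt_real_dreal p z.1.
Proof.
rewrite /in_rect /=; case/andP: hp => /ltW rp _.
have := @lt_real_dreal_trans _ _ _ z.1 rp.
by case: (lt_real_dreal p z.1) => [->//|_]; rewrite ?andbF ?andbT.
Qed.

Lemma in_lower_part (z : dpoint R) r q (hq : ymin r < q < ymax r) :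
  in_rect z (lower_part hq) = in_rect z r && ~~ lt_real_dreal q z.2.
Proof.
rewrite /in_rect /= -lt_dreal_realN; case/andP: hq => _ /ltW qr.
have := @lt_dreal_real_trans _ _ _ z.2 qr.
by case: (lt_dreal_real z.2 q) => [->//|_]; rewrite ?andbF ?andbT.
Qed.

Lemma in_upper_part (z : dpoint R) r q (hq : ymin r < q < ymax r) :
  in_rect z (upper_part hq) = in_rect z r && lt_real_dreal q z.2.
Proof.
rewrite /in_rect /=; case/andP: hq => /ltW rq _.
have := @lt_real_dreal_trans _ _ _ z.2 rq.
by case: (lt_real_dreal q z.2) => [->//|_]; rewrite ?andbF ?andbT.
Qed.

(** With [B] telling the side of a dividing line, this covers vertical and horizontal splittings
    alike: no decorated point lies on the line, so none is lost or counted twice. *)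
Lemma card_restr_split (A : rinterior D -> enat) r r1 r2
    (B : pred (dpoint R)) :
  (forall z, in_rect z r1 = in_rect z r && ~~ B z) ->
  (forall z, in_rect z r2 = in_rect z r && B z) ->
  card_restr A r = (card_restr A r1 + card_restr A r2)%E.
Proof.
move=> r1E r2E; rewrite /card_restr (esumID [set z | ~~ B (val z)]); last first.
  by move=> z _; exact: ereal_of_enat_ge0.
congr (_ + _)%E; congr esum; apply/seteqP; split=> z /=.
- by rewrite r1E => -[-> ->].
- by rewrite r1E => /andP[].
- by rewrite r2E => -[-> /negP]; rewrite negbK.
- by rewrite r2E => /andP[-> ->].
Qed.

Lemma card_restr_ge (A : rinterior D -> enat) (z : rinterior D) r :
  in_rect (val z) r -> (ereal_of_enat R (A z) <= card_restr A r)%E.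
Proof.
move=> zr; apply: esum_ge; exists [set z]; last by rewrite fsbig_set1.
by split; [exact: finite_set1 | move=> _ ->].
Qed.

Lemma card_restr_isolated (A : rinterior D -> enat) (z : rinterior D) r :
  in_rect (val z) r ->
  (forall y : rinterior D, in_rect (val y) r -> y != z -> A y = Some 0%N) ->
  card_restr A r = ereal_of_enat R (A z).
Proof.
move=> zr Ar; rewrite /card_restr (esumID [set z]); last first.
  by move=> y _; exact: ereal_of_enat_ge0.
rewrite [X in (_ + X)%E]esum1 => [|y [yr /eqP yz]]; last by rewrite Ar.
rewrite adde0 (_ : _ `&` _ = [set z]); last by apply/setIidPr => _ ->.
by rewrite esum_set1 ?ereal_of_enat_ge0.
Qed.

(** * Multiplicities of a natural-valued additive function on rectangles *)

Section Additive.
Variable nu : rect D -> nat.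
Hypothesis nu_x : forall r p (hp : xmin r < p < xmax r),
  nu r = (nu (left_part hp) + nu (right_part hp))%N.
Hypothesis nu_y : forall r q (hq : ymin r < q < ymax r),
  nu r = (nu (lower_part hq) + nu (upper_part hq))%N.

(** The sides of [r] are moved to those of [s] one at a time. Each move is trivial or passes to one
    part of a splitting, which cannot increase [nu]. *)
Lemma additive_mono s r : rect_le s r -> (nu s <= nu r)%N.
Proof.
move=> /and4P[]; rewrite le_eqVlt => le1 le2 le3 le4.
have [r1 [rs1 x1] [x2 y1 y2]] :
    exists2 r1, (nu r1 <= nu r)%N /\ xmin r1 = xmin s &
      [/\ xmax r1 = xmax r, ymin r1 = ymin r & ymax r1 = ymax r].
  case/orP: le1 => [/eqP ?|lt1]; first by exists r.
  have hp : xmin r < xmin s < xmax r by rewrite lt1 (lt_le_trans (rect_x s)).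
  by exists (right_part hp) => //; rewrite (nu_x hp) leq_addl.
rewrite le_eqVlt -x2 in le2.
have [r2 [rs2 x3] [x4 y3 y4]] :
    exists2 r2, (nu r2 <= nu r1)%N /\ xmin r2 = xmin s &
      [/\ xmax r2 = xmax s, ymin r2 = ymin r & ymax r2 = ymax r].
  case/orP: le2 => [/eqP ?|lt2]; first by exists r1; split.
  have hp : xmin r1 < xmax s < xmax r1 by rewrite lt2 x1 rect_x.
  by exists (left_part hp) => //; rewrite (nu_x hp) leq_addr.
rewrite le_eqVlt -y3 in le3.
have [r3 [rs3 x5] [x6 y5 y6]] :
    exists2 r3, (nu r3 <= nu r2)%N /\ xmin r3 = xmin s &
      [/\ xmax r3 = xmax s, ymin r3 = ymin s & ymax r3 = ymax r].
  case/orP: le3 => [/eqP ?|lt3]; first by exists r2; split.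
  have hq : ymin r2 < ymin s < ymax r2.
    by rewrite lt3 y4 (lt_le_trans (rect_y s)).
  by exists (upper_part hq) => //; rewrite (nu_y hq) leq_addl.
rewrite le_eqVlt -y6 in le4.
apply: (leq_trans _ (leq_trans rs3 (leq_trans rs2 rs1))).
case/orP: le4 => [/eqP ?|lt4]; first by rewrite (@rect_eq s r3).
have hq : ymin r3 < ymax s < ymax r3 by rewrite lt4 y5 rect_y.
have sE : s = lower_part hq by exact: rect_eq.
by rewrite (nu_y hq) -sE leq_addr.
Qed.

Lemma multiplicity_subproof (z : rinterior D) :
  exists n, `[< exists2 r, in_rect (val z) r & nu r = n >].
Proof.
by have [r zr] := set_valP z; exists (nu r); apply/asboolP; exists r.
Qed.

Definition multiplicity (z : rinterior D) : nat :=
  ex_minn (multiplicity_subproof z).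

Lemma multiplicity_le (z : rinterior D) r :
  in_rect (val z) r -> (multiplicity z <= nu r)%N.
Proof.
rewrite /multiplicity; case: ex_minnP => n _ n_min zr.
by apply: n_min; apply/asboolP; exists r.
Qed.

Lemma multiplicity_attained (z : rinterior D) :
  exists2 r, in_rect (val z) r & nu r = multiplicity z.
Proof. by rewrite /multiplicity; case: ex_minnP => n /asboolP. Qed.

Lemma multiplicity_eq0 (y z : rinterior D) r : y != z ->
  in_rect (val y) r -> in_rect (val z) r -> nu r = multiplicity z ->
  multiplicity y = 0%N.
Proof.
move=> yz yr zr rz.
(* The multiplicities of [y] and [z] add up to at most [nu r], which is the multiplicity of [z];
   cancelling it leaves 0 for [y]. *)
have sum_le r1 r2 : nu r = (nu r1 + nu r2)%N ->
    (in_rect (val y) r1 && in_rect (val z) r2) ||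
    (in_rect (val z) r1 && in_rect (val y) r2) ->
    multiplicity y = 0%N.
  move=> nuE /orP[]/andP[/multiplicity_le le1 /multiplicity_le le2]; lia.
have /and4P[y1 y2 y3 y4] := yr; have /and4P[z1 z2 z3 z4] := zr.
have [yz1|] := boolP ((val y).1 != (val z).1).
  have [p sep] := dreal_separated yz1.
  (* The line passes between two points of [r], hence cuts [r] properly. *)
  have hp : xmin r < p < xmax r.
    case/orP: sep => /andP[lt1 lt2].
      by rewrite (lt_real_dreal_real y1 lt1) (lt_real_dreal_real lt2 z2).
    by rewrite (lt_real_dreal_real z1 lt1) (lt_real_dreal_real lt2 y2).
  apply: (sum_le _ _ (nu_x hp)).
  by rewrite !in_left_part !in_right_part yr zr /= -!lt_dreal_realN.
rewrite negbK => /eqP eq1.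
have yz2 : (val y).2 != (val z).2.
  apply: contra yz => /eqP eq2; apply/eqP/val_inj.
  by move: eq1 eq2; case: (val y) (val z) => [? ?] [? ?] /= -> ->.
have [q sep] := dreal_separated yz2.
have hq : ymin r < q < ymax r.
  case/orP: sep => /andP[lt1 lt2].
    by rewrite (lt_real_dreal_real y3 lt1) (lt_real_dreal_real lt2 z4).
  by rewrite (lt_real_dreal_real z3 lt1) (lt_real_dreal_real lt2 y4).
apply: (sum_le _ _ (nu_y hq)).
by rewrite !in_lower_part !in_upper_part yr zr /= -!lt_dreal_realN.
Qed.

Lemma card_restr_multiplicity r :
  card_restr (fun z => Some (multiplicity z)) r = (nu r)%:R%:E.
Proof.
move: r; apply: rect_cousin => [r p hp lE rE|r q hq lE uE|z0 r0 z0r0].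
- rewrite (card_restr_split _ (fun z => in_left_part z hp)
    (fun z => in_right_part z hp)).
  by rewrite lE rE -EFinD -natrD -nu_x.
- rewrite (card_restr_split _ (fun z => in_lower_part z hq)
    (fun z => in_upper_part z hq)).
  by rewrite lE uE -EFinD -natrD -nu_y.
have z0D : rinterior D z0 by exists r0.
pose z : rinterior D := SigSub (mem_set z0D).
have [s zs sE] := multiplicity_attained z.
exists s => // s' s's zs'.
(* Minimality passes from [s] to every smaller rectangle around [z]: its measure is squeezed between
   the multiplicity of [z] and [nu s]. *)
have s'E : nu s' = multiplicity z.
  apply/eqP; rewrite eqn_leq multiplicity_le// -sE andbT.
  exact: additive_mono.
rewrite (@card_restr_isolated _ z) ?s'E// => y ys' yz.
by rewrite (multiplicity_eq0 yz ys' zs' s'E).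
Qed.

Lemma multiplicity_unique (A : rinterior D -> enat) :
    (forall r, card_restr A r = (nu r)%:R%:E) ->
  A = fun z => Some (multiplicity z).
Proof.
move=> AE; apply/funext => z.
have [s zs sE] := multiplicity_attained z.
apply: (@ereal_of_enat_inj R); rewrite -(@card_restr_isolated A z s) ?AE ?sE//.
(* Since [y] has multiplicity 0 for [nu], some rectangle [t] around [y] is null, and [A y] is at
   most the cardinality on [t]. *)
move=> y ys yz; have y0 := multiplicity_eq0 yz ys zs sE.
have [t yt tE] := multiplicity_attained y.
apply: (@ereal_of_enat_inj R); apply/eqP; rewrite eq_le ereal_of_enat_ge0 andbT.
by have := card_restr_ge A yt; rewrite AE tE y0.
Qed.

End Additive.

End Rectangles.

(** * The correspondence between multisets and measures *)

Theorem theorem2p8 (R : realType) (D : set (R * R)) :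
  exists Phi : (rinterior D -> enat) -> (rect D -> enat),
    set_bij (locally_finite_multisets D) (finite_rmeasures D) Phi /\
    forall A : rinterior D -> enat, locally_finite_multisets D A ->
    forall r : rect D, ereal_of_enat R (Phi A r) = card_restr A r.
Proof.
(* Cardinalities are extended naturals, so [Phi] is obtained by choice on all multisets, locally
   finite or not. *)
have [Phi PhiE] : exists Phi : (rinterior D -> enat) -> (rect D -> enat),
    forall A r, ereal_of_enat R (Phi A r) = card_restr A r.
  have ex_card A r : exists n, ereal_of_enat R n = card_restr (D := D) A r.
    exact: esum_ereal_of_enat.
  exists (fun A r => projT1 (cid (ex_card A r))) => A r.
  by case: (cid (ex_card A r)).
have Phi_fin A : locally_finite_multisets D A ->
    finite_rmeasures D (Phi A).
  move=> A_fin; split; last first.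
    by move=> r Ar; have := A_fin r; rewrite -PhiE Ar.
  split=> [r p hp|r q hq]; apply: (@ereal_of_enat_inj R);
    rewrite ereal_of_enatD !PhiE.
    exact: card_restr_split (fun z => in_left_part z hp)
      (fun z => in_right_part z hp).
  exact: card_restr_split (fun z => in_lower_part z hq)
    (fun z => in_upper_part z hq).
have nat_of mu : finite_rmeasures D mu -> exists nu : rect D -> nat,
    [/\ mu = fun r => Some (nu r),
     forall r p (hp : xmin r < p < xmax r),
       nu r = (nu (left_part hp) + nu (right_part hp))%N &
     forall r q (hq : ymin r < q < ymax r),
       nu r = (nu (lower_part hq) + nu (upper_part hq))%N].
  (* The default 0 is never taken, because [mu] is finite. *)
  move=> [[mu_x mu_y] mu_fin]; exists (fun r => odflt 0%N (mu r)).
  have muE r : mu r = Some (odflt 0%N (mu r)) by case: (mu r) (mu_fin r).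
  split=> [|r p hp|r q hq]; first exact/funext.
    by rewrite (mu_x _ _ hp) (muE (left_part hp)) (muE (right_part hp)).
  by rewrite (mu_y _ _ hq) (muE (lower_part hq)) (muE (upper_part hq)).
exists Phi; split=> //; split.
- exact: Phi_fin.
(* Injectivity: [A] and [B] both equal the multiplicity function of their common measure. *)
- move=> A B /set_mem A_fin /set_mem B_fin AB.
  have [nu [nuE nu_x nu_y]] := nat_of _ (Phi_fin _ A_fin).
  rewrite (multiplicity_unique nu_x nu_y (A := A)) => [|r].
    rewrite (multiplicity_unique nu_x nu_y (A := B)) // => r.
    by rewrite -PhiE -AB nuE.
  by rewrite -PhiE nuE.
- move=> mu /nat_of[nu [-> nu_x nu_y]].
  exists (fun z => Some (multiplicity nu z)).
    by move=> r; rewrite card_restr_multiplicity// ltry.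
  apply/funext => r; apply: (@ereal_of_enat_inj R).
  by rewrite PhiE card_restr_multiplicity.
Qed.
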